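(* Let $d,n$ be positive integers. The space $B_{d,n}$ (normalized real $d\times n$ matrices of Barvinok rank $2$) is homeomorphic to $(S^{d-2}\times S^{n-2})/\mathbb{Z}_2$, the quotient of the product of two spheres under the involution $(x,y)\mapsto(-x,-y)$ which sends each point to its antipode simultaneously in both components.
   Context: Tropical operations on $\mathbb{R}$: $a\odot b=a+b$, $a\oplus b=\min(a,b)$. On $\mathbb{R}^d$, $\oplus$ is taken coordinatewise and $\lambda\odot(x_1,\dots,x_d)=(\lambda+x_1,\dots,\lambda+x_d)$. The tropical convex hull of $S\subseteq\mathbb{R}^d$ is $\mathrm{tconv}(S)=\{\bigoplus_{x\in X}\lambda_x\odot x : \lambda_x\in\mathbb{R},\ \emptyset\ne X\subseteq S,\ |X|<\infty\}$. The Barvinok rank of a real $d\times n$ matrix $M$ is the smallest number of points in $\mathbb{R}^d$ whose tropical convex hull contains all columns of $M$. $B_{d,n}$ is the set of real $d\times n$ matrices $M$ of Barvinok rank $2$ such that (i) the first row of $M$ is zero; (ii) the smallest entry in every row of $M$ is zero; (iii) viewed as a point of $\mathbb{R}^{dn}$, $M$ lies on the (Euclidean) unit sphere. It carries the subspace topology from $\mathbb{R}^{dn}$. $S^{k}$ is the unit sphere in $\mathbb{R}^{k+1}$; in particular $S^{-1}=\emptyset$. *)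

(* Defs.v *)
From HB Require Import structures.
From mathcomp Require Import all_boot all_order all_algebra finmap.
From mathcomp Require Import generic_quotient.
From mathcomp Require Import all_classical all_reals all_analysis.

Set Implicit Arguments.
Unset Strict Implicit.
Unset Printing Implicit Defensive.

Import Order.TTheory GRing.Theory Num.Theory.
Import numFieldNormedType.Exports.

Local Open Scope classical_set_scope.
Local Open Scope ring_scope.

Section Barvinok.
Context {R : realType}.

(* The tropical sum is taken in R `|` {+oo}, where +oo is the neutral element
   of min; since X is nonempty, each coordinate of the sum is a real number. *)
Definition tconv (d : nat) (S : set 'cV[R]_d) : set 'cV[R]_d :=
  [set y | exists X : {fset 'cV[R]_d}, exists lam : 'cV[R]_d -> R,
     [/\ X != fset0, [set` X] `<=` S &
         forall i, (y i 0)%:E =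
           \big[Order.min/+oo%E]_(x <- X) (lam x + x i 0)%:E]].

Definition tconv_spanned (d n : nat) (M : 'M[R]_(d, n)) (r : nat) : Prop :=
  exists S : {fset 'cV[R]_d},
    #|` S| = r /\ forall j, tconv [set` S] (col j M).

Lemma tconv_sub (d : nat) (S : set 'cV[R]_d) : S `<=` tconv S.
Proof.
move=> y Sy; exists [fset y]%fset, (fun=> 0); split.
- by apply/fset0Pn; exists y; rewrite inE.
- by move=> x /=; rewrite inE => /eqP ->.
- by move=> i; rewrite big_seq_fset1 add0r.
Qed.

Lemma tconv_spanned_ex (d n : nat) (M : 'M[R]_(d, n)) :
  exists r, `[< tconv_spanned M r >].
Proof.
pose S : {fset 'cV[R]_d} := [fset col j M | j in 'I_n]%fset.
exists #|` S|; apply/asboolP; exists S; split=> // j; apply: tconv_sub.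
by apply/imfsetP; exists j.
Qed.

Definition barvinok_rank (d n : nat) (M : 'M[R]_(d, n)) : nat :=
  ex_minn (tconv_spanned_ex M).

End Barvinok.

(* The unit sphere S^(m-1) of R^m; it is empty when m = 0. *)
Definition unit_sphere (R : realType) (m : nat) : set 'rV[R]_m :=
  [set x | \sum_i x 0 i ^+ 2 = 1].
Arguments unit_sphere : clear implicits.

Definition barvinok_space (R : realType) (d n : nat) : set 'M[R]_(d, n) :=
  [set M | [/\ barvinok_rank M = 2,
               forall (i : 'I_d) (j : 'I_n), i = 0 :> nat -> M i j = 0,
               forall i : 'I_d,
                 (forall j, 0 <= M i j) /\ (exists j, M i j = 0) &
               unit_sphere R (d * n) (mxvec M)]].
Arguments barvinok_space : clear implicits.

Section Antipodal.
Context {R : realType}.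

Lemma unit_sphereN (m : nat) (x : 'rV[R]_m) :
  x \in unit_sphere R m -> - x \in unit_sphere R m.
Proof.
rewrite !inE /unit_sphere /= => <-.
by apply: eq_bigr => i _; rewrite mxE sqrrN.
Qed.

Definition antipode (m : nat) (x : unit_sphere R m) : unit_sphere R m :=
  exist _ (- \val x) (unit_sphereN (valP x)).

Lemma antipodeK (m : nat) : involutive (@antipode m).
Proof. by move=> x; apply: val_inj; rewrite /= opprK. Qed.

Variables p q : nat.
Local Notation SS := (unit_sphere R p * unit_sphere R q)%type.

Definition biantipode (z : SS) : SS := (antipode z.1, antipode z.2).

Lemma biantipodeK : involutive biantipode.
Proof. by case=> x y; rewrite /biantipode /= !antipodeK. Qed.

Definition biantipodal : rel SS := fun z w => (w == z) || (w == biantipode z).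

Lemma biantipodal_refl : reflexive biantipodal.
Proof. by move=> z; rewrite /biantipodal eqxx. Qed.

Lemma biantipodal_sym : symmetric biantipodal.
Proof.
move=> z w; rewrite /biantipodal eq_sym; congr (_ || _).
by apply/eqP/eqP => ->; rewrite biantipodeK.
Qed.

Lemma biantipodal_trans : transitive biantipodal.
Proof.
move=> w z t /orP[] /eqP-> /orP[] /eqP->; rewrite /biantipodal ?biantipodeK.
all: by rewrite eqxx ?orbT.
Qed.

Canonical biantipodal_equiv :=
  EquivRel biantipodal biantipodal_refl biantipodal_sym biantipodal_trans.

Definition sphere_prod_Z2 : Type := {eq_quot biantipodal}%qT.
HB.instance Definition _ := Quotient.on sphere_prod_Z2.
HB.instance Definition _ :=
  Topological.copy sphere_prod_Z2 (quotient_topology sphere_prod_Z2).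

End Antipodal.
Arguments sphere_prod_Z2 : clear implicits.

Definition homeomorphic (X Y : topologicalType) : Prop :=
  exists (f : X -> Y) (g : Y -> X),
    [/\ continuous f, continuous g, cancel f g & cancel g f].

(* Main.v *)
(* A matrix of Barvinok rank at most 2 has entries min(b_j + a_i, e_j + c_i).
   The normalization of its rows brings it to the form
     M_ij = max(0, min(x_i, y_j), min(-x_i, -y_j)),  x_0 = 0,
   and truncating x and y one may assume that max x = max y and
   min x = min y. Then |x_i| is the largest entry of row i, |y_j| the largest
   entry of column j, and M_ij > 0 tells which signs agree, so (x, y) is
   determined by M up to a global sign. The vector x is given by a point of
   S^(d-2) and a scale; y is determined by its direction modulo translations,
   a point of S^(n-2), as its scale and its position are fixed by the extrema
   of x; the common scale is fixed by the norm of M. The resulting continuous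
   bijection from the compact quotient to the Hausdorff space of matrices is a
   homeomorphism. *)
Require Import Defs.
From mathcomp Require Import all_boot all_order all_algebra finmap.
From mathcomp Require Import generic_quotient ring lra.
From mathcomp Require Import all_classical all_reals all_analysis.
Import numFieldNormedType.Exports.
Import Order.TTheory GRing.Theory Num.Theory.

Set Implicit Arguments.
Unset Strict Implicit.
Unset Printing Implicit Defensive.

Local Open Scope classical_set_scope.
Local Open Scope ring_scope.

(* Case analysis on innermost conditionals, whose comparisons are linear. *)
Ltac lra_minmax :=
  rewrite /Order.max /Order.min;
  repeat match goal with |- context [if (?x < ?y)%R then _ else _] =>
    lazymatch constr:((x, y)) with
    | context [if _ then _ else _] => fail
    | _ => case: (ltrP x y) => ?
    end
  end; intros; lra.

(** * Maximum, minimum and spread of a nonempty finite vector *)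

Section Extrema.
Context {R : realType} {k : nat}.
Implicit Types w : 'I_k.+1 -> R.

(** The starting value [w ord0] is itself an entry, so the fold is the true maximum even when all
    entries are negative. *)
Definition fmax w : R := \big[Num.max/w ord0]_i w i.
Definition fmin w : R := - fmax (fun i => - w i).
Definition spread w : R := fmax w - fmin w.

Lemma le_fmax w i : w i <= fmax w.
Proof. exact: le_bigmax. Qed.

Lemma fmax_attained w : exists i, w i = fmax w.
Proof.
rewrite /fmax; elim/big_ind: _ => [|a b [i <-] [j <-]|i _]; first by exists ord0.
  by rewrite /Num.max; case: ifP => _; [exists j|exists i].
by exists i.
Qed.

Lemma fmax_eq w c : (forall i, w i <= c) -> (exists i, w i = c) -> fmax w = c.
Proof.
move=> le_wc [i wi]; apply/le_anti; rewrite -{2}wi le_fmax andbT.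
by have [j <-] := fmax_attained w.
Qed.

Lemma fmin_le w i : fmin w <= w i.
Proof. by rewrite lerNl; apply: (le_fmax (fun i => - w i)). Qed.

Lemma fmin_attained w : exists i, w i = fmin w.
Proof.
by have [i wi] := fmax_attained (fun i => - w i); exists i; rewrite /fmin -wi opprK.
Qed.

Lemma fmin_eq w c : (forall i, c <= w i) -> (exists i, w i = c) -> fmin w = c.
Proof.
move=> le_cw [i wi]; rewrite /fmin (@fmax_eq _ (- c)) ?opprK //.
  by move=> j; rewrite lerN2.
by exists i; rewrite wi.
Qed.

Lemma fmaxN w : fmax (fun i => - w i) = - fmin w.
Proof. by rewrite opprK. Qed.

Lemma fminN w : fmin (fun i => - w i) = - fmax w.
Proof. by congr (- fmax _); apply/funext => i; rewrite opprK. Qed.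

Lemma spreadN w : spread (fun i => - w i) = spread w.
Proof. by rewrite /spread fmaxN fminN; ring. Qed.

Lemma fmax_affine c t w : 0 <= c -> fmax (fun i => c * w i + t) = c * fmax w + t.
Proof.
move=> c0; apply: fmax_eq => [i|]; first by rewrite lerD2r ler_wpM2l ?le_fmax.
by have [i <-] := fmax_attained w; exists i.
Qed.

Lemma fmin_affine c t w : 0 <= c -> fmin (fun i => c * w i + t) = c * fmin w + t.
Proof.
move=> c0; apply: fmin_eq => [i|]; first by rewrite lerD2r ler_wpM2l ?fmin_le.
by have [i <-] := fmin_attained w; exists i.
Qed.

Lemma spread_affine c t w : 0 <= c -> spread (fun i => c * w i + t) = c * spread w.
Proof. by move=> c0; rewrite /spread fmax_affine // fmin_affine //; ring. Qed.

Lemma spread_ge0 w : 0 <= spread w.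
Proof. by rewrite subr_ge0 (le_trans (fmin_le w ord0)) ?le_fmax. Qed.

Lemma spread_eq0 w i j : spread w = 0 -> w i = w j.
Proof.
move=> /subr0_eq E; have := le_fmax w i; have := le_fmax w j.
have := fmin_le w i; have := fmin_le w j; lra.
Qed.

End Extrema.

(** * The entry function of the normal form *)

Section Overlap.
Context {R : realType}.
Implicit Types a b c : R.

(** Length of the intersection of the segments from 0 to a and from 0 to b: min(|a|, |b|) for equal
    signs, 0 for opposite signs. *)
Definition overlap a b : R :=
  Num.max 0 (Num.max (Num.min a b) (Num.min (- a) (- b))).

Lemma overlapC a b : overlap a b = overlap b a.
Proof. by rewrite /overlap minC [Num.min (- a) _]minC. Qed.

Lemma overlapN a b : overlap (- a) (- b) = overlap a b.
Proof.
by rewrite /overlap !opprK maxCA !maxA [Num.max _ 0]maxC -!maxA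
  [X in Num.max 0 X]maxC.
Qed.

Lemma overlapZ c a b : 0 <= c -> overlap (c * a) (c * b) = c * overlap a b.
Proof.
move=> c0; rewrite /overlap maxr_pMr // mulr0 maxr_pMr // !minr_pMr //.
by rewrite !mulrN.
Qed.

Lemma overlap_ge0 a b : 0 <= overlap a b.
Proof. by rewrite le_max lexx. Qed.

Lemma overlap_le_norm a b : overlap a b <= `|a|.
Proof. by rewrite /overlap; case: (ger0P a) => ?; lra_minmax. Qed.

Lemma overlap_same_sign a b : `|a| <= `|b| -> 0 <= a * b -> overlap a b = `|a|.
Proof.
rewrite /overlap; case: (ger0P a) => a0; case: (ger0P b) => b0 ab ab0;
  [lra_minmax| |nra|lra_minmax].
have a_eq0 : a = 0 by nra.
lra_minmax.
Qed.

Lemma overlap_opposite a b : a * b <= 0 -> overlap a b = 0.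
Proof.
move=> ab; rewrite /overlap; apply/max_idPl; rewrite ge_max !ge_min.
by apply/andP; split; case: (lerP a 0) => a0 //=; nra.
Qed.

Lemma overlap_gt0 a b : 0 < a * b -> 0 < overlap a b.
Proof.
rewrite lt_max lt_max !lt_min !oppr_gt0 ltxx /= => ab.
case: (ltrgtP a 0) ab => [a0|a0|->]; last by rewrite mul0r ltxx.
  by rewrite nmulr_rgt0.
by rewrite pmulr_rgt0 // => ->.
Qed.

(** If b = -b' is nonzero, exactly one of ab and ab' is positive, so only one of the two overlaps
    vanishes. *)
Lemma overlap_inj a b b' :
  a != 0 -> `|b| = `|b'| -> overlap a b = overlap a b' -> b = b'.
Proof.
move=> a0 /eqP; rewrite eqr_norm2 => /orP[/eqP//|/eqP->] {b}.
have [->|b0] := eqVneq b' 0; first by rewrite oppr0.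
have : a * b' != 0 by rewrite mulf_neq0.
case: (ltrgtP (a * b') 0) => // ab _ E; exfalso.
  have := @overlap_gt0 a (- b'); rewrite E overlap_opposite ?ltxx ?(ltW ab) //.
  by rewrite mulrN oppr_gt0 => /(_ ab).
have := overlap_gt0 ab; rewrite -E overlap_opposite ?ltxx //.
by rewrite mulrN oppr_le0 ltW.
Qed.

Lemma overlap_pos a b : 0 <= a -> 0 <= b -> overlap a b = Num.min a b.
Proof.
wlog ab : a b / a <= b => [H a0 b0|a0 b0].
  by case: (leP a b) => [|/ltW] ab; [|rewrite overlapC]; rewrite H // (min_idPl _).
by rewrite (min_idPl ab) overlap_same_sign ?mulr_ge0 ?ger0_norm.
Qed.

Lemma overlap_clamp_pos (P Q a b : R) :
  Q <= 0 -> 0 <= P -> Num.min a b <= P -> 0 < a -> 0 < b ->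
  overlap (Num.max Q (Num.min P a)) (Num.max Q (Num.min P b)) = overlap a b.
Proof.
move=> Q0 P0 abP a0 b0.
have cl_ge0 c : 0 < c -> Num.max Q (Num.min P c) = Num.min P c.
  by move=> c0; apply/max_idPr; rewrite (le_trans Q0) // le_min P0 ltW.
rewrite !cl_ge0 // !overlap_pos ?le_min ?P0 ?ltW //.
by rewrite minACA minxx; apply/min_idPr.
Qed.

(** Truncation to the interval [Q, P] around 0 reverses no sign, and for equal signs the overlap
    sees only the argument closer to 0, which the hypotheses place inside the interval. *)
Lemma overlap_clamp (P Q a b : R) :
  Q <= 0 -> 0 <= P -> Num.min a b <= P -> Q <= Num.max a b ->
  overlap (Num.max Q (Num.min P a)) (Num.max Q (Num.min P b)) = overlap a b.
Proof.
move=> Q0 P0 abP abQ.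
have cl_ge0 c : 0 <= c -> 0 <= Num.max Q (Num.min P c).
  by move=> c0; rewrite le_max le_min P0 c0 orbT.
have cl_le0 c : c <= 0 -> Num.max Q (Num.min P c) <= 0.
  by move=> c0; rewrite ge_max Q0 ge_min c0 orbT.
(* Reflection in 0 exchanges the bounds and reduces two negative arguments to the positive case. *)
have opp c : Num.max Q (Num.min P c) = - Num.max (- P) (Num.min (- Q) (- c)).
  by rewrite oppr_max oppr_min !opprK max_minr (max_idPr (le_trans Q0 P0)).
case: (lerP a 0) => a0; case: (lerP b 0) => b0.
- have [a00|an0] := eqVneq a 0.
    have : Num.max Q (Num.min P a) = 0 by rewrite a00 (min_idPr P0); apply/max_idPr.
    by move=> ->; rewrite a00 !overlap_opposite ?mul0r.
  have [b00|bn0] := eqVneq b 0.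
    have : Num.max Q (Num.min P b) = 0 by rewrite b00 (min_idPr P0); apply/max_idPr.
    by move=> ->; rewrite b00 !overlap_opposite ?mulr0.
  rewrite !opp overlapN overlap_clamp_pos ?oppr_le0 ?oppr_ge0 ?oppr_gt0 ?overlapN //.
  + by rewrite -oppr_max lerN2.
  + by rewrite lt_neqAle an0.
  + by rewrite lt_neqAle bn0.
- by rewrite !overlap_opposite // mulr_le0_ge0 ?cl_ge0 ?cl_le0 // ltW.
- by rewrite !overlap_opposite // mulr_ge0_le0 ?cl_ge0 ?cl_le0 // ltW.
exact: overlap_clamp_pos.
Qed.

End Overlap.

(** * Balanced pairs: uniqueness up to a common sign, and existence by truncation *)

Section Balanced.
Context {R : realType}.

Definition balanced (m k : nat) (x : 'I_m.+1 -> R) (y : 'I_k.+1 -> R) : Prop :=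
  fmax x = fmax y /\ fmin x = fmin y.

Lemma balanced_sym m k (x : 'I_m.+1 -> R) (y : 'I_k.+1 -> R) :
  balanced x y -> balanced y x.
Proof. by case. Qed.

Lemma balancedN m k (x : 'I_m.+1 -> R) (y : 'I_k.+1 -> R) :
  balanced x y -> balanced (fun i => - x i) (fun j => - y j).
Proof. by move=> [eM em]; rewrite /balanced !fmaxN !fminN eM em. Qed.

Lemma balancedZ m k (x : 'I_m.+1 -> R) (y : 'I_k.+1 -> R) c : 0 <= c ->
  balanced x y -> balanced (fun i => c * x i) (fun j => c * y j).
Proof.
have fZ l (w : 'I_l.+1 -> R) : (fun i => c * w i) = (fun i => c * w i + 0).
  by apply/funext => i; rewrite addr0.
move=> c0 [eM em]; rewrite !fZ; split; first by rewrite !fmax_affine // eM.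
by rewrite !fmin_affine // em.
Qed.

(** Since x and y share their extrema, the extremum of y on the same side of 0 as x_i is at least as
    far from 0 as x_i. *)
Lemma balanced_overlap_attained m k (x : 'I_m.+1 -> R) (y : 'I_k.+1 -> R) i :
  balanced x y -> exists j, overlap (x i) (y j) = `|x i|.
Proof.
move=> [eM em]; case: (lerP 0 (x i)) => x0.
  have [j yj] := fmax_attained y; exists j.
  have xy : x i <= y j by rewrite yj -eM le_fmax.
  rewrite overlap_same_sign ?mulr_ge0 ?(le_trans x0) //.
  by rewrite !ger0_norm ?(le_trans x0).
have [j yj] := fmin_attained y; exists j.
have xy : y j <= x i by rewrite yj -em fmin_le.
rewrite overlap_same_sign ?mulr_le0 ?(le_trans xy) ?(ltW x0) //.
by rewrite !ler0_norm ?(le_trans xy) ?(ltW x0) // lerN2.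
Qed.

Lemma balanced_overlap_norm m k (x x' : 'I_m.+1 -> R) (y y' : 'I_k.+1 -> R) :
    balanced x y -> balanced x' y' ->
    (forall i j, overlap (x i) (y j) = overlap (x' i) (y' j)) ->
  forall i, `|x i| = `|x' i|.
Proof.
move=> b b' E i; apply/le_anti/andP; split.
  by have [j <-] := balanced_overlap_attained i b; rewrite E overlap_le_norm.
by have [j <-] := balanced_overlap_attained i b'; rewrite -E overlap_le_norm.
Qed.

(** The moduli are already known as row and column maxima. Row [i0] fixes the signs in y; a column
    where y is nonzero then fixes the signs in x. *)
Lemma balanced_overlap_eq m k (x x' : 'I_m.+1 -> R) (y y' : 'I_k.+1 -> R) i0 :
    balanced x y -> balanced x' y' -> x i0 != 0 -> x i0 = x' i0 ->
    (forall i j, overlap (x i) (y j) = overlap (x' i) (y' j)) ->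
  x = x' /\ y = y'.
Proof.
move=> b b' x0 xi0 E.
have Nx := balanced_overlap_norm b b' E.
have Ny : forall j, `|y j| = `|y' j|.
  apply: (balanced_overlap_norm (balanced_sym b) (balanced_sym b')) => j i.
  by rewrite overlapC E overlapC.
have yE j : y j = y' j by apply: (overlap_inj x0) => //; rewrite E xi0.
have [j0 y0] := balanced_overlap_attained i0 b.
have {}y0 : y j0 != 0.
  apply: contraNneq x0 => yj0; move: y0; rewrite yj0 overlap_opposite ?mulr0 //.
  by move/esym/eqP; rewrite normr_eq0.
split; apply/funext => // i; apply: (overlap_inj y0) => //.
by rewrite overlapC E overlapC yE.
Qed.

Lemma balanced_overlap_eq_opp m k (x x' : 'I_m.+1 -> R) (y y' : 'I_k.+1 -> R) i0 :
    balanced x y -> balanced x' y' -> x i0 != 0 ->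
    (forall i j, overlap (x i) (y j) = overlap (x' i) (y' j)) ->
  (x = x' /\ y = y') \/
  (x = (fun i => - x' i) /\ y = (fun j => - y' j)).
Proof.
move=> b b' x0 E.
have /eqP := balanced_overlap_norm b b' E i0.
rewrite eqr_norm2 => /orP[/eqP xi|/eqP xi]; [left|right].
  exact: balanced_overlap_eq xi E.
apply: (balanced_overlap_eq b (balancedN b') x0 xi) => i j.
by rewrite overlapN.
Qed.

Lemma clamp_balanced m k (w : 'I_m.+1 -> R) (z : 'I_k.+1 -> R) :
    w ord0 = 0 -> fmin z <= 0 -> 0 <= fmax z ->
  exists (x : 'I_m.+1 -> R) (y : 'I_k.+1 -> R),
    [/\ balanced x y, x ord0 = 0 &
      forall i j, overlap (x i) (y j) = overlap (w i) (z j)].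
Proof.
move=> w0 zm zM.
(* [Q, P] is the intersection of the ranges of w and z. Truncated to it, both vectors attain exactly
   Q and P; it contains 0, so coordinate 0 is kept. *)
pose P := Num.min (fmax w) (fmax z); pose Q := Num.max (fmin w) (fmin z).
have wm : fmin w <= 0 by rewrite -w0 fmin_le.
have wM : 0 <= fmax w by rewrite -w0 le_fmax.
have P0 : 0 <= P by rewrite le_min wM.
have Q0 : Q <= 0 by rewrite ge_max wm.
pose cl (a : R) := Num.max Q (Num.min P a).
have fmax_cl l (v : 'I_l.+1 -> R) : P <= fmax v -> fmax (cl \o v) = P.
  move=> Pv; apply: fmax_eq => [i|].
    by rewrite /= /cl ge_max (le_trans Q0) //= ge_min lexx.
  have [i vi] := fmax_attained v; exists i.
  by rewrite /= /cl vi (min_idPl Pv); apply/max_idPr/(le_trans Q0).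
have fmin_cl l (v : 'I_l.+1 -> R) : fmin v <= Q -> fmin (cl \o v) = Q.
  move=> Pv; apply: fmin_eq => [i|]; first by rewrite /= /cl le_max lexx.
  have [i vi] := fmin_attained v; exists i.
  by rewrite /= /cl vi; apply/max_idPl; rewrite ge_min Pv orbT.
exists (cl \o w), (cl \o z); split.
- split; first by rewrite !fmax_cl // /P ge_min lexx ?orbT.
  by rewrite !fmin_cl // /Q le_max lexx ?orbT.
- rewrite /= w0 /cl (min_idPr P0); exact/max_idPr.
move=> i j; rewrite /= overlap_clamp //.
- by rewrite /P le_min !ge_min !le_fmax ?orbT.
- by rewrite /Q ge_max !le_max !fmin_le ?orbT.
Qed.

End Balanced.

(** * Tropical hulls of at most two points *)

Section TropicalSpan.
Context {R : realType}.

(** Nonemptiness keeps the minimum away from [+oo]; from here on tropical sums are handled by real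
    inequalities. *)
Lemma bigmin_EFinP (T : eqType) (s : seq T) (f : T -> R) (y : R) : s != [::] ->
  y%:E = \big[Order.min/+oo%E]_(x <- s) (f x)%:E <->
  (forall x, x \in s -> y <= f x) /\ exists2 x, x \in s & y = f x.
Proof.
move=> s0; split=> [yE|[le_y [x xs yx]]].
  split=> [x xs|]; first by rewrite -lee_fin yE; apply: bigmin_inf_seq xs _ _.
  elim: s s0 y yE => // x [|x' s] IH _ y.
    by rewrite big_seq1 => -[->]; exists x; rewrite ?inE.
  rewrite big_cons => yE.
  have [|le_x] := leP (f x)%:E (\big[Order.min/+oo%E]_(i <- x' :: s) (f i)%:E).
    move=> /min_idPl E; move: yE; rewrite E => -[->].
    by exists x; rewrite ?inE ?eqxx.
  move: yE; rewrite (min_idPr (ltW le_x)) => /IH[]// z zs ->.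
  by exists z; rewrite // inE zs orbT.
apply/le_anti/andP; split.
  rewrite big_seq; elim/big_ind: _ => [|a b ya yb|i i_s]; first exact: leey.
    by rewrite le_min ya.
  by rewrite lee_fin le_y.
by rewrite yx; apply: bigmin_inf_seq xs _ _.
Qed.

Lemma tconv_sub1 d (S : set 'cV[R]_d) (p y : 'cV[R]_d) :
  S `<=` [set p] -> tconv S y -> exists b, forall i, y i 0 = b + p i 0.
Proof.
move=> Sp [X [lam [X0 XS yE]]]; exists (lam p) => i.
have X0' : (X : seq _) != [::] by rewrite -size_eq0 cardfs_eq0.
have [_ [x xX ->]] := (bigmin_EFinP _ _ X0').1 (yE i).
by rewrite (Sp x) // ; exact: XS.
Qed.

Lemma tconv_fset2 d (p q y : 'cV[R]_d) : tconv [set` [fset p; q]%fset] y <->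
  exists b e, forall i, y i 0 = Num.min (b + p i 0) (e + q i 0).
Proof.
split=> [[X [lam [X0 XS yE]]]|[b [e yE]]].
  have X0' : (X : seq _) != [::] by rewrite -size_eq0 cardfs_eq0.
  (* The sum may involve only one of p and q. A missing point gets the coefficient [K], too large to
     bring the minimum below y. *)
  pose K : R := \sum_i (`|y i 0| + `|p i 0| + `|q i 0|).
  have leK i : `|y i 0| + `|p i 0| + `|q i 0| <= K.
    by rewrite /K (bigD1 i) //= lerDl sumr_ge0.
  pose mu (x : 'cV[R]_d) := if x \in X then lam x else K.
  exists (mu p), (mu q) => i.
  have [yle [x xX yx]] := (bigmin_EFinP _ _ X0').1 (yE i).
  have Hle (z : 'cV[R]_d) : `|z i 0| <= `|p i 0| + `|q i 0| ->
      y i 0 <= mu z + z i 0.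
    rewrite /mu; case: ifPn => [/yle//|_] zle.
    have := leK i; have := ler_norm (y i 0); have := lerNnormlW (lexx `|z i 0|).
    lra.
  apply/le_anti/andP; split.
    by rewrite le_min !Hle ?lerDl ?lerDr.
  have -> : y i 0 = mu x + x i 0 by rewrite /mu xX.
  by have /= := XS x xX; rewrite !inE => /orP[] /eqP->; rewrite ge_min lexx ?orbT.
exists [fset p; q]%fset.
(* [lam] is a function of the point, so for p = q the two coefficients merge into their minimum. *)
have [pq|pq] := eqVneq p q.
  exists (fun=> Num.min b e); split=> //.
    by apply/fset0Pn; exists p; rewrite !inE eqxx.
  move=> i; apply/bigmin_EFinP.
    by rewrite -size_eq0 cardfs_eq0; apply/fset0Pn; exists p; rewrite !inE eqxx.
  rewrite yE -pq -addr_minl; split=> [x|]; last by exists p; rewrite // !inE eqxx.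
  by rewrite !inE orbb => /eqP->.
exists (fun x => if x == p then b else e); split=> //.
  by apply/fset0Pn; exists p; rewrite !inE eqxx.
move=> i; apply/bigmin_EFinP.
  by rewrite -size_eq0 cardfs_eq0; apply/fset0Pn; exists p; rewrite !inE eqxx.
rewrite yE; split=> [x|].
  rewrite !inE => /orP[] /eqP->; first by rewrite eqxx ge_min lexx.
  by rewrite eq_sym (negPf pq) ge_min lexx orbT.
have [le_be|lt_eb] := leP (b + p i 0) (e + q i 0).
  by exists p; rewrite ?eqxx // !inE eqxx.
by exists q; rewrite 1?eq_sym ?(negPf pq) // !inE eqxx orbT.
Qed.

Lemma tconv_spanned2P d n (M : 'M[R]_(d, n)) : tconv_spanned M 2 <->
  exists p q b e, p != q :> 'cV[R]_d /\
    forall i j, M i j = Num.min (b j + p i 0) (e j + q i 0).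
Proof.
split=> [[S [S2 SM]]|[p [q [b [e [pq ME]]]]]].
  have [p [q [pq Spq]]] : exists p q, p != q /\ S = [fset p; q]%fset.
    have /fset0Pn[p pS] : S != fset0 by rewrite -cardfs_eq0 S2.
    have /cardfs1P[q Sq] : #|` (S `\ p)%fset| == 1%N.
      by have := cardfsD1 p S; rewrite S2 pS add1n => -[<-].
    have : q \in (S `\ p)%fset by rewrite Sq inE.
    rewrite !inE => /andP[qp _]; exists p, q; split; first by rewrite eq_sym.
    by rewrite -(fsetD1K pS) Sq.
  have /choice[be beE] : forall j, exists be : R * R,
      forall i, M i j = Num.min (be.1 + p i 0) (be.2 + q i 0).
    move=> j; have := SM j; rewrite Spq => /tconv_fset2[b [e E]].
    by exists (b, e) => i; have := E i; rewrite mxE.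
  by exists p, q, (fst \o be), (snd \o be); split.
exists [fset p; q]%fset; split; first by rewrite cardfs2 pq.
move=> j; apply/tconv_fset2; exists (b j), (e j) => i.
by rewrite mxE ME.
Qed.

Lemma tconv_spanned_lt2 d n (M : 'M[R]_(d, n)) r : tconv_spanned M r -> (r < 2)%N ->
  exists (p : 'cV[R]_d) b, forall i j, M i j = b j + p i 0.
Proof.
move=> [S [Sr SM]] r2.
have [p Sp] : exists p : 'cV[R]_d, [set` S] `<=` [set p].
  case: r Sr r2 => [/eqP|[/eqP|//]] + _.
    (* The empty set lies in every singleton; the point 0 is an arbitrary choice. *)
    by rewrite cardfs_eq0 => /eqP->; exists 0 => x /=; rewrite inE.
  by move=> /cardfs1P[p ->]; exists p => x /=; rewrite inE => /eqP.
have /choice[b bE] : forall j, exists b : R, forall i, M i j = b + p i 0.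
  move=> j; have [b bE] := tconv_sub1 Sp (SM j); exists b => i.
  by have := bE i; rewrite mxE.
by exists p, b.
Qed.

End TropicalSpan.

(** * Normal form of the matrices in the Barvinok space *)

Section NormalForm.
Context {R : realType}.

Lemma minr_eq0 (u v : R) :
  Num.min u v = 0 -> [/\ 0 <= u, 0 <= v & u = 0 \/ v = 0].
Proof.
move=> uv; have : 0 <= Num.min u v by rewrite uv.
rewrite le_min => /andP[u0 v0]; split=> //.
by case: (leP u v) uv; [left|right].
Qed.

(** u and v are the positive and negative parts of u - v, and t and s those of t - s; the four cases
    are the sign patterns. *)
Lemma min_add_overlap (u v s t : R) : Num.min u v = 0 -> Num.min s t = 0 ->
  Num.min (s + u) (t + v) = overlap (u - v) (t - s).
Proof.
move=> /minr_eq0[u0 v0 uv] /minr_eq0[s0 t0 st].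
case: uv => ->; case: st => ->; rewrite ?addr0 ?add0r ?subr0 ?sub0r.
- by rewrite (min_idPl _) ?addr_ge0 // overlap_opposite // mulNr oppr_le0 mulr_ge0.
- by rewrite overlapN overlapC overlap_pos.
- by rewrite overlap_pos // minC.
- by rewrite (min_idPr _) ?addr_ge0 // overlap_opposite // mulrN oppr_le0 mulr_ge0.
Qed.

(* When every e_j exceeds b_j, row i vanishes somewhere without a_i or c_i
   vanishing; moving s = min_j (e_j - b_j) from e to c repairs this, at the cost
   of replacing c_0 = 0 by s, which does not affect the zero row 0. *)
Lemma min_overlap_shift m k (a c : 'I_m.+1 -> R) (b e : 'I_k.+1 -> R) s
    (z := fun j => e j - b j - s) :
    a ord0 = 0 -> c ord0 = 0 -> (forall j, Num.min (b j) (e j) = 0) ->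
    (forall i j, 0 <= Num.min (b j + a i) (e j + c i)) ->
    (forall i, exists j, Num.min (b j + a i) (e j + c i) = 0) ->
    (s = 0 /\ fmin z <= 0 <= fmax z) \/
      (0 <= s /\ fmin z = 0) ->
  exists (x : 'I_m.+1 -> R) (y : 'I_k.+1 -> R),
    [/\ balanced x y, x ord0 = 0 &
      forall i j, Num.min (b j + a i) (e j + c i) = overlap (x i) (y j)].
Proof.
move=> a0 c0 be0 M0 Mz zs.
have s0 : 0 <= s by case: zs => [[->]|[]].
have [j0 zj0] := fmin_attained z.
have [j1 zj1] := fmax_attained z.
have zjs j : s = 0 \/ 0 <= z j.
  by case: zs => [[->]|[_ zm]]; [left|right; rewrite -zm fmin_le].
have zm : fmin z <= 0 by case: zs => [[_ /andP[]]|[_ ->]].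
have zM : 0 <= fmax z.
  by case: zs => [[_ /andP[]]//|[_ <-]]; rewrite (le_trans (fmin_le z ord0)) ?le_fmax.
(* Column [j1], where z is largest, has b = 0 and gives a_i >= 0; column [j0], where z is smallest,
   has e <= s and gives c_i + s >= 0. A zero of row i makes one of the two vanish. *)
have ac i : Num.min (a i) (c i + s) = 0.
  have [j /minr_eq0[? ? Mij]] := Mz i; have [? ? bej] := minr_eq0 (be0 j).
  have [? ? bej0] := minr_eq0 (be0 j0); have [? ? bej1] := minr_eq0 (be0 j1).
  have := M0 i j0; have := M0 i j1; rewrite !le_min => /andP[? ?] /andP[? ?].
  move: zM zm (zjs j) (zjs j0) (zjs j1); rewrite -zj0 -zj1 /z => zM' zm'.
  move=> zsj zsj0 zsj1.
  have a_ge0 : 0 <= a i by case: bej1 => ?; lra.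
  have c_ge0 : 0 <= c i + s by case: bej0 => ?; case: zsj0; lra.
  have ac_eq0 : a i = 0 \/ c i + s = 0.
    by case: Mij => ?; case: bej => ?; case: zsj => ?; (left; lra) || (right; lra).
  by case: ac_eq0 => ac; rewrite ac; [apply/min_idPl|apply/min_idPr].
(* At index 0 the difference would be -s; the value 0 serves instead because row 0 of the matrix
   vanishes. *)
pose w i := if i == ord0 then 0 else a i - c i - s.
have [x [y [xy x0 E]]] := clamp_balanced (erefl : w ord0 = 0) zm zM.
exists x, y; split=> // i j; rewrite E /w.
have bes : Num.min (b j) (e j - s) = 0.
  have [b_ge0 e_ge0 be] := minr_eq0 (be0 j).
  case: (zjs j) => [->|zj]; first by rewrite subr0.
  have b_eq0 : b j = 0 by rewrite /z in zj; case: be => ?; lra.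
  by rewrite b_eq0; apply/min_idPl; rewrite /z b_eq0 subr0 in zj.
have [->|_] := eqVneq i ord0.
  by rewrite a0 c0 !addr0 overlap_opposite ?mul0r.
rewrite -[e j in LHS](subrK s) -addrA [s + _]addrC min_add_overlap // /z.
by congr overlap; ring.
Qed.

Lemma min_overlap m k (a c : 'I_m.+1 -> R) (b e : 'I_k.+1 -> R)
    (M : 'I_m.+1 -> 'I_k.+1 -> R) :
    (forall i j, M i j = Num.min (b j + a i) (e j + c i)) ->
    (forall j, M ord0 j = 0) -> (forall i j, 0 <= M i j) ->
    (forall i, exists j, M i j = 0) ->
  exists (x : 'I_m.+1 -> R) (y : 'I_k.+1 -> R),
    [/\ balanced x y, x ord0 = 0 & forall i j, M i j = overlap (x i) (y j)].
Proof.
(* Constants may pass from [a] to [b] and from [c] to [e]. *)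
wlog [a0 c0] : a c b e / a ord0 = 0 /\ c ord0 = 0.
  move=> H ME; apply: (H (fun i => a i - a ord0) (fun i => c i - c ord0)
    (fun j => b j + a ord0) (fun j => e j + c ord0)); first by rewrite !subrr.
  by move=> i j; rewrite ME; congr Num.min; ring.
(* Exchanging the two generating points negates e - b. *)
wlog zM : a c b e a0 c0 / 0 <= fmax (fun j => e j - b j).
  move=> H; have [|zM] := leP 0 (fmax (fun j => e j - b j)); first exact: H.
  move=> ME; apply: (H c a e b) => // [|i j]; last by rewrite minC ME.
  rewrite (_ : (fun j => _) = (fun j => - (e j - b j))); last first.
    by apply/funext => j; rewrite opprB.
  by rewrite fmaxN oppr_ge0 (le_trans (le_trans (fmin_le _ ord0) (le_fmax _ _))) ?ltW.
move=> ME M0 Mge0 Mz.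
(* [s] is nonzero exactly when every e_j exceeds b_j; the two cases of this maximum are the two
   alternatives of [min_overlap_shift]. *)
pose s := Num.max 0 (fmin (fun j => e j - b j)).
have H := @min_overlap_shift _ _ a c b e s.
have [||||x [y [xy x0 xyE]]] := H a0 c0;
  last by exists x, y; split=> // i j; rewrite ME.
- by move=> j; have := M0 j; rewrite ME a0 c0 !addr0.
- by move=> i j; rewrite -ME.
- by move=> i; have [j] := Mz i; exists j; rewrite -ME.
have zE : (fun j => e j - b j - s) = (fun j => 1 * (e j - b j) + - s).
  by apply/funext => j; rewrite mul1r.
rewrite zE fmin_affine // fmax_affine // !mul1r /s.
have [m0|m0] := leP (fmin (fun j => e j - b j)) 0; [left|right].
  by rewrite !subr0 m0.
split; [exact: ltW|exact: subrr].
Qed.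

Definition overlap_mx m k (x : 'I_m.+1 -> R) (y : 'I_k.+1 -> R) :
  'M[R]_(m.+1, k.+1) :=
  \matrix_(i, j) overlap (x i) (y j).

Lemma sum_mxvec d n (M : 'M[R]_(d, n)) :
  \sum_i mxvec M 0 i ^+ 2 = \sum_i \sum_j M i j ^+ 2.
Proof.
rewrite pair_bigA (reindex _ (curry_mxvec_bij _ _)) /=.
by apply: eq_bigr => -[i j] _; rewrite mxvecE.
Qed.

(** As x_0 = 0, the common range of x and y contains 0, so the extremum of y on the side opposite to
    x_i gives no overlap. *)
Lemma overlap_attains0 m k (x : 'I_m.+1 -> R) (y : 'I_k.+1 -> R) i :
  x ord0 = 0 -> balanced x y -> exists j, overlap (x i) (y j) = 0.
Proof.
move=> x0 [eM em].
have [ym yM] : fmin y <= 0 /\ 0 <= fmax y by rewrite -em -eM -x0 fmin_le le_fmax.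
have [xi|xi] := leP 0 (x i).
  have [j yj] := fmin_attained y; exists j.
  by rewrite overlap_opposite // yj mulr_ge0_le0.
have [j yj] := fmax_attained y; exists j.
by rewrite overlap_opposite // yj mulr_le0_ge0 // ltW.
Qed.

(** The positive and negative parts of x are two generating points. With fewer points, all columns
    would be translates of one vector; the zero row 0 makes them equal, and the zero in each row
    makes the matrix zero. *)
Lemma barvinok_rank_overlap m k (x : 'I_m.+1 -> R) (y : 'I_k.+1 -> R) :
  x ord0 = 0 -> balanced x y -> overlap_mx x y != 0 ->
  barvinok_rank (overlap_mx x y) = 2%N.
Proof.
move=> x0 xy M0; rewrite /barvinok_rank; case: ex_minnP => r /asboolP rP rmin.
apply/eqP; rewrite eqn_leq; apply/andP; split.
  apply/rmin/asboolP/tconv_spanned2P.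
  pose pos (t : R) := Num.max t 0; pose neg (t : R) := Num.max (- t) 0.
  have posB t : pos t - neg t = t by rewrite /pos /neg; lra_minmax.
  have neg_pos t : Num.min (neg t) (pos t) = 0 by rewrite /pos /neg; lra_minmax.
  exists (\col_i pos (x i)), (\col_i neg (x i)), (neg \o y), (pos \o y); split.
    (* Equal generating points would force x = 0 and hence a zero matrix. *)
    apply: contraNneq M0 => /colP pn; apply/eqP/matrixP => i j; rewrite !mxE.
    have : x i = 0.
      by rewrite -[LHS]posB; have := pn i; rewrite !mxE => ->; rewrite subrr.
    by move=> ->; rewrite overlap_opposite ?mul0r.
  move=> i j; rewrite !mxE min_add_overlap.
  - by rewrite /= !posB.
  - by rewrite minC.
  - exact: neg_pos.
rewrite leqNgt; apply: contraNN M0 => /(tconv_spanned_lt2 rP)[p [b ME]].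
have bE j : b j = - p ord0 0.
  have := ME ord0 j; rewrite mxE x0 overlap_opposite ?mul0r //.
  by move/eqP; rewrite eq_sym addr_eq0 => /eqP.
apply/eqP/matrixP => i j.
have [j' {}M0] := overlap_attains0 i x0 xy.
by rewrite ME bE -(bE j') -ME !mxE.
Qed.

(** Replaces the tropical definition by balanced pairs. In the converse, norm 1 excludes the zero
    matrix, as [barvinok_rank_overlap] requires. *)
Lemma barvinok_spaceP m k (M : 'M[R]_(m.+1, k.+1)) :
  barvinok_space R m.+1 k.+1 M <->
  exists x y, [/\ x ord0 = 0, balanced x y, M = overlap_mx x y &
    \sum_i \sum_j M i j ^+ 2 = 1].
Proof.
split=> [[rk M0 Mrow M1]|[x [y [x0 xy ME M1]]]].
  have [p [q [b [e [_ ME]]]]] : exists p q b e, p != q :> 'cV[R]_m.+1 /\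
      forall i j, M i j = Num.min (b j + p i 0) (e j + q i 0).
    apply/tconv_spanned2P; move: rk; rewrite /barvinok_rank.
    by case: ex_minnP => r /asboolP + _ r2; rewrite (r2 : r = 2%N).
  have [|i j|i|x [y [xy x0 E]]] := min_overlap ME.
  - by move=> j; apply: M0.
  - by have [+ _] := Mrow i; apply.
  - by have [] := Mrow i.
  exists x, y; split=> //; last by rewrite -sum_mxvec.
  by apply/matrixP => i j; rewrite mxE.
have Mn0 : overlap_mx x y != 0.
  apply: contra_eqN M1; rewrite -ME => /eqP->.
  rewrite big1 => [|i _]; first by rewrite eq_sym oner_eq0.
  by rewrite big1 // => j _; rewrite mxE expr0n.
split; last by rewrite /unit_sphere /= sum_mxvec.
- by rewrite ME barvinok_rank_overlap.
- move=> i j i0; have -> : i = ord0 by apply/val_inj.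
  by rewrite ME mxE x0 overlap_opposite ?mul0r.
move=> i; split=> [j|]; first by rewrite ME mxE overlap_ge0.
have [j' M0] := overlap_attains0 i x0 xy.
by exists j'; rewrite ME mxE.
Qed.

End NormalForm.

(** * Parametrization by pairs of points on two spheres *)

Section Parametrization.
Context {R : realType}.

(** The representative with coordinate 0 equal to 0 of a vector modulo constants; thus directions
    modulo translation in R^(m+1) become points of the unit sphere of R^m. *)
Definition cons0 m (u : 'rV[R]_m) (i : 'I_m.+1) : R :=
  oapp (u 0) 0 (unlift ord0 i).

Lemma cons0_0 m (u : 'rV[R]_m) : cons0 u ord0 = 0.
Proof. by rewrite /cons0 unlift_none. Qed.

Lemma cons0_lift m (u : 'rV[R]_m) i : cons0 u (lift ord0 i) = u 0 i.
Proof. by rewrite /cons0 liftK. Qed.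

Lemma cons0N m (u : 'rV[R]_m) : cons0 (- u) = (fun i => - cons0 u i).
Proof.
apply/funext => i; rewrite /cons0.
by case: unlift => [j|] /=; rewrite ?mxE ?oppr0.
Qed.

Lemma unit_sphere_neq0 m (u : 'rV[R]_m) : unit_sphere R m u -> u != 0.
Proof.
move=> u1; apply: contra_eqN u1 => /eqP->.
rewrite big1 => [|i _]; first by rewrite eq_sym oner_eq0.
by rewrite mxE expr0n.
Qed.

Lemma spread_cons0_gt0 m (u : 'rV[R]_m) :
  unit_sphere R m u -> 0 < spread (cons0 u).
Proof.
move=> /unit_sphere_neq0 u0; rewrite lt_neqAle spread_ge0 andbT eq_sym.
apply: contraNneq u0 => s0; apply/eqP/rowP => i.
by rewrite mxE -cons0_lift (spread_eq0 _ ord0 s0) cons0_0.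
Qed.

(** Comparing norms gives a = a'. *)
Lemma sphere_colinear m (u u' : 'rV[R]_m) (a a' : R) : 0 < a -> 0 < a' ->
  unit_sphere R m u -> unit_sphere R m u' -> a *: u = a' *: u' -> u = u'.
Proof.
move=> a0 a0' u1 u1' E.
have sqZ (b : R) w : unit_sphere R m w -> \sum_i (b *: w) 0 i ^+ 2 = b ^+ 2.
  rewrite /unit_sphere /= => w1; rewrite -[RHS]mulr1 -w1 mulr_sumr.
  by apply: eq_bigr => i _; rewrite mxE exprMn.
have aa : a = a'.
  by apply: (pexpIrn (_ : 0 < 2)%N); rewrite ?nnegrE ?ltW // -(sqZ a u) // E sqZ.
by move: E; rewrite aa => /scalerI; apply; rewrite gt_eqF.
Qed.

(** Polar coordinates for the differences x_i - x_0, whose norm is positive because x is not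
    constant. *)
Lemma cons0_polar m (x : 'I_m.+1 -> R) : spread x != 0 ->
  exists (a : R) (u : 'rV[R]_m), [/\ 0 < a, unit_sphere R m u &
    x = (fun i => a * cons0 u i + x ord0)].
Proof.
move=> sx; pose w : 'rV[R]_m := \row_i (x (lift ord0 i) - x ord0).
pose n2 := \sum_i w 0 i ^+ 2.
have n20 : 0 < n2.
  rewrite lt_neqAle sumr_ge0 ?andbT => [|i _]; last exact: sqr_ge0.
  rewrite eq_sym; apply: contraNneq sx => /eqP.
  rewrite psumr_eq0 => [/allP w0|i _]; last exact: sqr_ge0.
  rewrite (_ : x = (fun i => 0 * x i + x ord0)).
    by rewrite spread_affine // mul0r.
  apply/funext => i; rewrite mul0r add0r; case: (unliftP ord0 i) => [j|] -> //.
  have := w0 j (mem_index_enum _); rewrite /= sqrf_eq0 mxE subr_eq0.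
  by move/eqP.
have s0 : 0 < Num.sqrt n2 by rewrite sqrtr_gt0.
exists (Num.sqrt n2), ((Num.sqrt n2)^-1 *: w); split=> //.
  rewrite /unit_sphere /=; under eq_bigr do rewrite mxE exprMn.
  by rewrite -mulr_sumr exprVn sqr_sqrtr ?ltW // mulVf ?gt_eqF.
apply/funext => i; case: (unliftP ord0 i) => [j|] ->; last first.
  by rewrite cons0_0 mulr0 add0r.
by rewrite cons0_lift !mxE mulVKf ?gt_eqF // subrK.
Qed.

(* Cross-scaling by the spreads avoids denominators and gives both vectors the
   spread [spread (cons0 u) * spread (cons0 v)]. *)
Definition row_param m k (u : 'rV[R]_m) (v : 'rV[R]_k) i : R :=
  spread (cons0 v) * cons0 u i.

(** The added constant makes the minimum equal to that of [row_param]; as the spreads agree, so do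
    the maxima. *)
Definition col_param m k (u : 'rV[R]_m) (v : 'rV[R]_k) j : R :=
  spread (cons0 u) * cons0 v j +
  (spread (cons0 v) * fmin (cons0 u) - spread (cons0 u) * fmin (cons0 v)).

Lemma row_param0 m k (u : 'rV[R]_m) (v : 'rV[R]_k) : row_param u v ord0 = 0.
Proof. by rewrite /row_param cons0_0 mulr0. Qed.

Lemma row_paramN m k (u : 'rV[R]_m) (v : 'rV[R]_k) :
  row_param (- u) (- v) = (fun i => - row_param u v i).
Proof. by apply/funext => i; rewrite /row_param !cons0N spreadN mulrN. Qed.

(** Negation replaces the minima in the constant by negated maxima. Aligning maxima or minima gives
    the same constant, because the scaled spreads agree. *)
Lemma col_paramN m k (u : 'rV[R]_m) (v : 'rV[R]_k) :
  col_param (- u) (- v) = (fun i => - col_param u v i).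
Proof.
apply/funext => i; rewrite /col_param !cons0N !spreadN !fminN.
by rewrite /spread; ring.
Qed.

Lemma param_balanced m k (u : 'rV[R]_m) (v : 'rV[R]_k) :
  balanced (row_param u v) (col_param u v).
Proof.
have -> : row_param u v = (fun i => spread (cons0 v) * cons0 u i + 0).
  by apply/funext => i; rewrite addr0.
rewrite /balanced /col_param !fmax_affine ?fmin_affine ?spread_ge0 //.
by rewrite /spread; split; ring.
Qed.

Lemma param_inj m k (u u' : 'rV[R]_m) (v v' : 'rV[R]_k) (a a' : R) :
    0 < a -> 0 < a' ->
    unit_sphere R m u -> unit_sphere R m u' ->
    unit_sphere R k v -> unit_sphere R k v' ->
    (forall i, a * row_param u v i = a' * row_param u' v' i) ->
    (forall j, a * col_param u v j = a' * col_param u' v' j) ->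
  u = u' /\ v = v'.
Proof.
move=> a0 a0' u1 u1' v1 v1' Er Ec.
have [su su'] := (spread_cons0_gt0 u1, spread_cons0_gt0 u1').
have [sv sv'] := (spread_cons0_gt0 v1, spread_cons0_gt0 v1').
split.
  apply: (@sphere_colinear _ _ _ (a * spread (cons0 v)) (a' * spread (cons0 v'))) => //.
  - exact: mulr_gt0.
  - exact: mulr_gt0.
  apply/rowP => i; rewrite !mxE -!mulrA -!(cons0_lift _ i); exact: Er.
apply: (@sphere_colinear _ _ _ (a * spread (cons0 u)) (a' * spread (cons0 u'))) => //.
- exact: mulr_gt0.
- exact: mulr_gt0.
apply/rowP => j; rewrite !mxE -!mulrA -!(cons0_lift _ j).
(* Subtracting the equation at index 0 eliminates the additive constants. *)
have := Ec (lift ord0 j); have := Ec ord0; rewrite /col_param !cons0_0.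
set t := _ - _; set t' := _ - _; lra.
Qed.

(** The Euclidean norm of the entries, as opposed to the maximum norm. *)
Definition mxnorm m k (M : 'M[R]_(m, k)) : R := Num.sqrt (\sum_i \sum_j M i j ^+ 2).

Lemma mxnorm_gt0 m k (M : 'M[R]_(m, k)) : M != 0 -> 0 < mxnorm M.
Proof.
move=> M0; rewrite sqrtr_gt0 lt_neqAle eq_sym.
have ge0 i : 0 <= \sum_j M i j ^+ 2 by apply: sumr_ge0 => j _; apply: sqr_ge0.
rewrite sumr_ge0 // andbT; apply: contra M0.
rewrite psumr_eq0 // => /allP Mi; apply/eqP/matrixP => i j; rewrite mxE.
have := Mi i (mem_index_enum _); rewrite psumr_eq0 => [/allP Mij|j' _];
  last exact: sqr_ge0.
by have := Mij j (mem_index_enum _); rewrite sqrf_eq0 => /eqP.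
Qed.

Lemma mxnormZ m k (M : 'M[R]_(m, k)) c : 0 <= c -> mxnorm (c *: M) = c * mxnorm M.
Proof.
move=> c0; rewrite /mxnorm -{2}(ger0_norm c0) -sqrtr_sqr -sqrtrM ?sqr_ge0 //.
congr Num.sqrt; rewrite mulr_sumr; apply: eq_bigr => i _.
by rewrite mulr_sumr; apply: eq_bigr => j _; rewrite mxE exprMn.
Qed.

Lemma mxnorm_eq1 m k (M : 'M[R]_(m, k)) :
  mxnorm M = 1 <-> \sum_i \sum_j M i j ^+ 2 = 1.
Proof.
rewrite /mxnorm; split=> [|->]; last exact: sqrtr1.
set S := \sum_i _; have S0 : 0 <= S.
  by apply: sumr_ge0 => i _; apply: sumr_ge0 => j _; apply: sqr_ge0.
by move=> E; rewrite -(sqr_sqrtr S0) E expr1n.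
Qed.

Definition normalize m k (M : 'M[R]_(m, k)) := (mxnorm M)^-1 *: M.

Lemma overlap_mxZ m k (x : 'I_m.+1 -> R) (y : 'I_k.+1 -> R) c : 0 <= c ->
  overlap_mx (fun i => c * x i) (fun j => c * y j) = c *: overlap_mx x y.
Proof. by move=> c0; apply/matrixP => i j; rewrite !mxE overlapZ. Qed.

Lemma overlap_mx_neq0 m k (x : 'I_m.+1 -> R) (y : 'I_k.+1 -> R) i :
  balanced x y -> x i != 0 -> overlap_mx x y != 0.
Proof.
move=> xy; have [j xyij] := balanced_overlap_attained i xy.
by apply: contraNneq => /matrixP/(_ i j); rewrite !mxE xyij => /eqP;
  rewrite normr_eq0.
Qed.

Definition param m k (u : 'rV[R]_m) (v : 'rV[R]_k) : 'M[R]_(m.+1, k.+1) :=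
  overlap_mx (row_param u v) (col_param u v).

Lemma row_param_neq0 m k (u : 'rV[R]_m) (v : 'rV[R]_k) :
  unit_sphere R m u -> unit_sphere R k v -> exists i, row_param u v i != 0.
Proof.
move=> u1 v1; have [i ui] : exists i, u 0 i != 0.
  apply/existsP; apply: contraNT (unit_sphere_neq0 u1); rewrite negb_exists.
  by move=> /forallP u0; apply/eqP/rowP => i; rewrite mxE; apply/eqP/negbNE/u0.
exists (lift ord0 i).
by rewrite /row_param cons0_lift mulf_neq0 // gt_eqF // spread_cons0_gt0.
Qed.

Lemma mxnorm_param_gt0 m k (u : 'rV[R]_m) (v : 'rV[R]_k) :
  unit_sphere R m u -> unit_sphere R k v -> 0 < mxnorm (param u v).
Proof.
move=> u1 v1; have [i xi] := row_param_neq0 u1 v1.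
exact/mxnorm_gt0/(overlap_mx_neq0 (param_balanced u v) xi).
Qed.

Lemma paramN m k (u : 'rV[R]_m) (v : 'rV[R]_k) : param (- u) (- v) = param u v.
Proof.
rewrite /param row_paramN col_paramN.
by apply/matrixP => i j; rewrite !mxE overlapN.
Qed.

Lemma normalize_param_barvinok m k (u : 'rV[R]_m) (v : 'rV[R]_k) :
  unit_sphere R m u -> unit_sphere R k v ->
  barvinok_space R m.+1 k.+1 (normalize (param u v)).
Proof.
move=> u1 v1; have N0 := mxnorm_param_gt0 u1 v1.
have c0 : 0 <= (mxnorm (param u v))^-1 by rewrite invr_ge0 ltW.
apply/barvinok_spaceP.
exists (fun i => (mxnorm (param u v))^-1 * row_param u v i),
  (fun i => (mxnorm (param u v))^-1 * col_param u v i); split.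
- by rewrite row_param0 mulr0.
- exact/balancedZ/param_balanced.
- by rewrite overlap_mxZ.
- by apply/mxnorm_eq1; rewrite /normalize mxnormZ // mulVf // gt_eqF.
Qed.

(** The matrix determines the scaled vectors up to a common sign; the negative sign is absorbed by
    passing to the antipodes of u' and v'. *)
Lemma normalize_param_inj m k (u u' : 'rV[R]_m) (v v' : 'rV[R]_k) :
    unit_sphere R m u -> unit_sphere R m u' ->
    unit_sphere R k v -> unit_sphere R k v' ->
    normalize (param u v) = normalize (param u' v') ->
  (u = u' /\ v = v') \/ (u = - u' /\ v = - v').
Proof.
move=> u1 u1' v1 v1'; rewrite /normalize.
have := mxnorm_param_gt0 u1 v1; have := mxnorm_param_gt0 u1' v1'.
rewrite -(invr_gt0 (mxnorm (param u v))) -(invr_gt0 (mxnorm (param u' v'))).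
(* The inverse norms become arbitrary positive scalars, which homogeneity moves into the two
   vectors. *)
move: (mxnorm _)^-1 (mxnorm _)^-1 => c' c c'0 c0.
rewrite /param -!overlap_mxZ ?ltW // => /matrixP E.
have [i xi] := row_param_neq0 u1 v1.
have cxi : c * row_param u v i != 0 by rewrite mulf_neq0 // gt_eqF.
have [|[/funeqP Ex /funeqP Ey]|[/funeqP Ex /funeqP Ey]] := balanced_overlap_eq_opp
    (balancedZ (ltW c0) (param_balanced u v))
    (balancedZ (ltW c'0) (param_balanced u' v')) cxi.
- by move=> i0 j0; have := E i0 j0; rewrite !mxE.
- left; exact: (param_inj c0 c'0).
right; apply: (param_inj c0 c'0) => //.
- by apply/set_mem/unit_sphereN/mem_set.
- by apply/set_mem/unit_sphereN/mem_set.
- by move=> i0; rewrite Ex row_paramN mulrN.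
- by move=> j0; rewrite Ey col_paramN mulrN.
Qed.

Lemma normalize_param_surj m k (M : 'M[R]_(m.+1, k.+1)) :
  barvinok_space R m.+1 k.+1 M ->
  exists u v,
    [/\ unit_sphere R m u, unit_sphere R k v & M = normalize (param u v)].
Proof.
move=> /barvinok_spaceP[x [y [x0 [eM em] ME /mxnorm_eq1 M1]]].
have sxy : spread x = spread y by rewrite /spread eM em.
have sx : spread x != 0.
  (* A constant x is zero because x_0 = 0, and would give the zero matrix. *)
  apply: contra_eqN M1 => /eqP sx0; rewrite (_ : M = 0 *: 0) ?mxnormZ //.
    by rewrite mul0r eq_sym oner_eq0.
  rewrite ME scale0r; apply/matrixP => i j; rewrite !mxE.
  by rewrite (spread_eq0 i ord0 sx0) x0 overlap_opposite ?mul0r.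
have [a [u [a0 u1 xE]]] := cons0_polar sx.
have sy : spread y != 0 by rewrite -sxy.
have [b [v [b0 v1 yE]]] := cons0_polar sy.
exists u, v; split=> //.
have [su sv] := (spread_cons0_gt0 u1, spread_cons0_gt0 v1).
have abs : a * spread (cons0 u) = b * spread (cons0 v).
  by move: sxy; rewrite xE yE !spread_affine ?ltW.
have abm : a * fmin (cons0 u) = b * fmin (cons0 v) + y ord0.
  by move: em; rewrite {1}xE {1}yE !fmin_affine ?ltW // x0 addr0.
(* Comparing [row_param u v] with x = a * [cons0 u] forces this ratio; by [abs] and [abm] it is also
   the ratio of [col_param u v] to y. *)
pose c := spread (cons0 v) / a.
have c0 : 0 < c by rewrite divr_gt0.
have -> : param u v = c *: M.
  rewrite ME -overlap_mxZ ?ltW //; congr overlap_mx; apply/funext => i.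
    rewrite {1}xE x0 /row_param /c addr0; field; exact: lt0r_neq0.
  rewrite {1}yE /col_param /c; apply: (mulfI (lt0r_neq0 a0)).
  have -> : y ord0 = a * fmin (cons0 u) - b * fmin (cons0 v).
    by rewrite abm addrC addKr.
  transitivity (b * spread (cons0 v) * cons0 v i +
      (a * spread (cons0 v) * fmin (cons0 u) -
       b * spread (cons0 v) * fmin (cons0 v))); first by rewrite -abs; ring.
  by field; exact: lt0r_neq0.
rewrite /normalize mxnormZ ?ltW // M1 mulr1 scalerA mulVf ?scale1r //.
exact: lt0r_neq0.
Qed.

End Parametrization.

(** * Compactness and continuity *)

Section Topology.

Lemma set_type_hausdorff (X : topologicalType) (A : set X) :
  hausdorff_space X -> hausdorff_space (set_type A).
Proof.
move=> hX p q pq; apply/val_inj/hX => U V pU qV.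
have cval : continuous (set_val : set_type A -> X) := @initial_continuous _ _ _.
by have [z [Uz Vz]] := pq _ _ (cval p U pU) (cval q V qV); exists (set_val z).
Qed.

(** A filter on the subtype is pushed forward along the inclusion. Its cluster point in A is one in
    the subtype too, whose open sets are preimages of open sets. *)
Lemma set_type_compact (X : topologicalType) (A : set X) :
  compact A -> compact [set: set_type A].
Proof.
move=> cA F PF _.
have [|p [Ap pF]] := cA (set_val @ F).
  by apply: (@filterE _ F) => x; exact: set_valP.
exists (exist _ p (mem_set Ap)); split=> // B C FB [_ [[W oW <-] Wp WC]].
have [||_ [[z Bz <-] Wz]] := pF (set_val @` B) W.
- by apply: (@filterS _ F) FB => z Bz; exists z.
- exact: open_nbhs_nbhs.
by exists z; split=> //; apply: WC.
Qed.

(** The preimage of a closed set under the inverse of g is its image under g, which is compact and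
    hence closed. *)
Lemma compact_hausdorff_homeomorphic (X Y : topologicalType) (g : Y -> X) :
    compact [set: Y] -> hausdorff_space X -> continuous g -> injective g ->
    (forall x, exists y, g y = x) ->
  homeomorphic X Y.
Proof.
move=> cY hX cg g_inj /choice[f fK].
have gK : cancel g f by move=> y; apply: g_inj; rewrite fK.
exists f, g; split=> //; apply/continuous_closedP => C clC.
have -> : f @^-1` C = g @` C.
  apply/seteqP; split=> [x Cfx|_ [y Cy <-]]; first by exists (f x).
  by rewrite /= gK.
apply: compact_closed => //; apply: continuous_compact.
  exact: continuous_subspaceT.
exact: subclosed_compact clC cY _.
Qed.

Context {R : realType}.

(** A neighbourhood of a matrix contains a product of neighbourhoods of its finitely many
    entries. *)
Lemma mx_continuous (T : topologicalType) m k (f : T -> 'M[R]_(m, k)) z :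
  (forall i j, {for z, continuous (fun t => f t i j)}) -> {for z, continuous f}.
Proof.
move=> cf A [P Pz PA]; rewrite /nbhs /=.
have : \forall t \near z, forall i j, P i j (f t i j).
  apply: filter_forall => i; apply: filter_forall => j.
  exact: (cf i j _ (Pz i j)).
by apply: filterS => t Pt; apply: PA.
Qed.

Lemma fmax_continuous (T : topologicalType) k (w : T -> 'I_k.+1 -> R) :
  (forall i, continuous (fun t => w t i)) -> continuous (fun t => fmax (w t)).
Proof.
move=> cw; rewrite /fmax; elim: (index_enum _) => [|i s IH].
  by under eq_fun do rewrite big_nil; apply: cw.
under eq_fun do rewrite big_cons.
by move=> z; apply: continuous_max; [apply: cw|apply: IH].
Qed.

Lemma fmin_continuous (T : topologicalType) k (w : T -> 'I_k.+1 -> R) :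
  (forall i, continuous (fun t => w t i)) -> continuous (fun t => fmin (w t)).
Proof.
move=> cw z; apply: cvgN; apply: fmax_continuous => i {}z.
by apply: cvgN; apply: cw.
Qed.

Lemma spread_continuous (T : topologicalType) k (w : T -> 'I_k.+1 -> R) :
  (forall i, continuous (fun t => w t i)) -> continuous (fun t => spread (w t)).
Proof.
by move=> cw z; apply: cvgB; [apply: fmax_continuous|apply: fmin_continuous].
Qed.

Lemma overlap_continuous (T : topologicalType) (f g : T -> R) :
  continuous f -> continuous g -> continuous (fun t => overlap (f t) (g t)).
Proof.
move=> cf cg z.
have cN (h : T -> R) : continuous h -> {for z, continuous (fun t => - h t)}.
  by move=> ch; apply: cvgN; apply: ch.
apply: (@continuous_max R T (fun=> 0) (fun t => Num.max (Num.min (f t) (g t))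
  (Num.min (- f t) (- g t)))); first exact: cvg_cst.
apply: (@continuous_max R T (f \min g) ((fun t => - f t) \min (fun t => - g t))).
  by apply: continuous_min; [apply: cf|apply: cg].
by apply: continuous_min; apply: cN.
Qed.

Lemma cons0_continuous (T : topologicalType) k (w : T -> 'rV[R]_k) i :
  continuous w -> continuous (fun t => cons0 (w t) i).
Proof.
move=> cw z; rewrite /cons0; case: (unlift ord0 i) => [j|] /=; last exact: cvg_cst.
exact: (continuous_comp (cw z) (@coord_continuous _ _ _ 0 j _)).
Qed.

Lemma param_continuous (T : topologicalType) m k (u : T -> 'rV[R]_m)
    (v : T -> 'rV[R]_k) i j :
  continuous u -> continuous v -> continuous (fun t => param (u t) (v t) i j).
Proof.
move=> cu cv; under eq_fun do rewrite mxE.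
have su : continuous (fun t => spread (cons0 (u t))).
  by apply: spread_continuous => l; apply: cons0_continuous.
have sv : continuous (fun t => spread (cons0 (v t))).
  by apply: spread_continuous => l; apply: cons0_continuous.
have mu : continuous (fun t => fmin (cons0 (u t))).
  by apply: fmin_continuous => l; apply: cons0_continuous.
have mv : continuous (fun t => fmin (cons0 (v t))).
  by apply: fmin_continuous => l; apply: cons0_continuous.
apply: overlap_continuous => z.
  by apply: cvgM; [apply: sv|apply: cons0_continuous].
apply: cvgD; first by apply: cvgM; [apply: su|apply: cons0_continuous].
apply: cvgB; apply: cvgM.
- exact: sv.
- exact: mu.
- exact: su.
- exact: mv.
Qed.

Lemma sum_sqr_continuous (T : topologicalType) (I : finType) (f : I -> T -> R) :
  (forall i, continuous (f i)) -> continuous (fun t => \sum_i f i t ^+ 2).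
Proof.
move=> cf; apply: continuous_big => [|i _ z]; first exact: add_continuous.
exact: (continuous_comp (cf i z) (@exprn_continuous R 2 _)).
Qed.

Lemma mxnorm_continuous (T : topologicalType) m k (f : T -> 'M[R]_(m, k)) :
  (forall i j, continuous (fun t => f t i j)) -> continuous (fun t => mxnorm (f t)).
Proof.
move=> cf z; apply: (continuous_comp _ (@sqrt_continuous R _)).
have -> : (fun t => \sum_i \sum_j f t i j ^+ 2) =
    (fun t => \sum_(ij : 'I_m * 'I_k) f t ij.1 ij.2 ^+ 2).
  by apply/funext => t; rewrite pair_bigA.
by apply: (sum_sqr_continuous (f := fun ij t => f t ij.1 ij.2)) => -[i j]; apply: cf.
Qed.

Lemma unit_sphere_compact m : compact (unit_sphere R m).
Proof.
apply: bounded_closed_compact.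
  exists 1; split=> // M M1 x x1.
  suff : mx_norm x <= M by [].
  rewrite mx_normrE bigmax_le //=.
    exact: le_trans (ltW M1).
  move=> -[i j] _ /=; apply: le_trans (ltW M1); rewrite ord1.
  (* The square of one coordinate is at most the whole sum, which is 1. *)
  rewrite -(@expr_le1 _ 2) // -normrX ger0_norm ?sqr_ge0 // -x1 (bigD1 j) //=.
  by rewrite lerDl sumr_ge0 // => j' _; apply: sqr_ge0.
rewrite (_ : unit_sphere R m =
  (fun x : 'rV[R]_m => \sum_i x 0 i ^+ 2) @^-1` [set 1]) //.
apply: preimage_closed; last exact: closed_eq.
by move=> x _; apply: sum_sqr_continuous => i; apply: coord_continuous.
Qed.

Lemma sphere_prod_Z2_compact p q : compact [set: sphere_prod_Z2 R p q].
Proof.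
have <- : range (\pi_(sphere_prod_Z2 R p q)%qT) = setT.
  by apply/seteqP; split=> // x _; exists (repr x); rewrite ?reprK.
apply: continuous_compact.
  apply: continuous_subspaceT; exact: pi_continuous.
rewrite -setXTT; apply: compact_setX; apply: set_type_compact;
  exact: unit_sphere_compact.
Qed.

End Topology.

(** * The map from the product of spheres and its descent to the quotient *)

Section Main.
Context {R : realType} (m k : nat).
Local Notation SS := (unit_sphere R m * unit_sphere R k)%type.

Definition barvinok_param (z : SS) : set_type (barvinok_space R m.+1 k.+1) :=
  exist (fun M => M \in barvinok_space R m.+1 k.+1) _ (mem_set
    (normalize_param_barvinok (set_valP z.1) (set_valP z.2))).

(** In the subspace topology, continuity can be checked on matrix entries, which are quotients by a
    nonvanishing norm. *)
Lemma barvinok_param_continuous : continuous barvinok_param.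
Proof.
apply: continuous_comp_initial => z.
have cpr1 : continuous (fun z : SS => \val z.1).
  move=> t; apply: (cvg_comp _ _ (@cvg_fst _ _ _ _ _)); exact: initial_continuous.
have cpr2 : continuous (fun z : SS => \val z.2).
  move=> t; apply: (cvg_comp _ _ (@cvg_snd _ _ _ _ _)); exact: initial_continuous.
apply: mx_continuous => i j.
rewrite (_ : (fun t => _) = (fun t : SS =>
    (mxnorm (param (\val t.1) (\val t.2)))^-1 *
    param (\val t.1) (\val t.2) i j)); last by apply/funext => t; rewrite /= mxE.
apply: cvgM; last exact: (param_continuous cpr1 cpr2).
apply: cvgV; last first.
  exact: (mxnorm_continuous (f := fun t : SS => param (\val t.1) (\val t.2))
    (fun _ _ => param_continuous cpr1 cpr2)).
by rewrite gt_eqF // mxnorm_param_gt0 //; apply: set_valP.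
Qed.

(** The fibres are the antipodal orbits, so the induced map on the quotient is well defined and
    injective. *)
Lemma barvinok_param_eq z w :
  barvinok_param z = barvinok_param w <-> biantipodal z w.
Proof.
have [z1 z2] := (set_valP z.1, set_valP z.2).
have [w1 w2] := (set_valP w.1, set_valP w.2).
split=> [/(congr1 val) /= E|].
  rewrite biantipodal_sym; apply/orP.
  have [[E1 E2]|[E1 E2]] := normalize_param_inj z1 w1 z2 w2 E; [left|right].
    by apply/eqP; rewrite [z]surjective_pairing [w]surjective_pairing;
      congr pair; apply: val_inj.
  by apply/eqP; rewrite [z]surjective_pairing; congr pair; apply: val_inj.
by move=> /orP[] /eqP-> //; apply: val_inj; rewrite /= paramN.
Qed.

End Main.

Theorem theorem1p1 (R : realType) (d n : nat) (d_gt0 : (0 < d)%N)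
    (n_gt0 : (0 < n)%N) :
  homeomorphic (set_type (barvinok_space R d n)) (sphere_prod_Z2 R d.-1 n.-1).
Proof.
(* With d = m + 1 and n = k + 1, the spheres S^(d-2) and S^(n-2) are the unit spheres of R^m and
   R^k. *)
case: d n d_gt0 n_gt0 => [//|m] [//|k] _ _.
refine (@compact_hausdorff_homeomorphic (set_type (barvinok_space R m.+1 k.+1))
  (sphere_prod_Z2 R m k) (fun q => barvinok_param (repr q)) _ _ _ _ _).
- exact: sphere_prod_Z2_compact.
- exact/set_type_hausdorff/norm_hausdorff.
(* Continuity of the composite with the choice [repr] of representatives follows from constancy on
   orbits. *)
- apply: repr_comp_continuous; first exact: barvinok_param_continuous.
  by move=> z w /eqP /eqmodP /barvinok_param_eq ->.
- move=> q q' /barvinok_param_eq /eqmodP.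
  by rewrite !reprK.
move=> [M MB].
have [u [v [u1 v1 ME]]] := normalize_param_surj (set_mem MB).
pose z : unit_sphere R m * unit_sphere R k :=
  (exist _ u (mem_set u1), exist _ v (mem_set v1)).
exists (\pi_(sphere_prod_Z2 R m k) z)%qT.
(* The representative of the class of z may be the antipode of z, but it has the same image. *)
have /barvinok_param_eq -> :
    biantipodal (repr (\pi_(sphere_prod_Z2 R m k) z)%qT) z.
  by apply/eqmodP; rewrite reprK.
by apply: val_inj; rewrite /= -ME.
Qed.
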